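(* The functor $\ell^2 \colon \mathbf{PInj} \to \mathbf{Hilb}$ is symmetric (strong) monoidal with respect to $\oplus$: the canonical isomorphism between the $0$-dimensional Hilbert space and $\ell^2(\emptyset)$, together with the natural morphisms $\ell^2(X) \oplus \ell^2(Y) \to \ell^2(X \oplus Y)$ mapping $(\varphi,\psi)$ to the cotuple $[\varphi,\psi] \colon X \oplus Y \to \mathbb{C}$, which are isomorphisms, satisfy the coherence conditions of a symmetric strong monoidal functor.
   Context: $\mathbf{Hilb}$ is the category of complex Hilbert spaces and continuous linear functions, with symmetric monoidal structure given by the direct sum $\oplus$ of Hilbert spaces, with unit the $0$-dimensional Hilbert space. $\mathbf{PInj}$ is the category whose objects are sets and whose morphisms $X \to Y$ are partial injections, i.e. partial functions that are injective on their domain of definition, composed as relations. The symmetric monoidal structure $\oplus$ on $\mathbf{PInj}$ is given by disjoint union on objects and on morphisms, with unit the empty set. The cotuple $[\varphi,\psi]$ is the function on the disjoint union $X \oplus Y$ that restricts to $\varphi$ on $X$ and to $\psi$ on $Y$. The functor $\ell^2 \colon \mathbf{PInj} \to \mathbf{Hilb}$ sends a set $X$ to $\ell^2(X) = \{\varphi \colon X \to \mathbb{C} \mid \sum_{x\in X} |\varphi(x)|^2 < \infty\}$ with inner product $\langle \varphi | \psi\rangle = \sum_{x \in X} \overline{\varphi(x)}\psi(x)$, and sends a partial injection $f \colon X \to Y$ to the linear map $\ell^2 f \colon \ell^2(X) \to \ell^2(Y)$ with $(\ell^2 f)(\varphi)(y) = \varphi(x)$ if there is a (necessarily unique) $x$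 in the domain of definition of $f$ with $f(x) = y$, and $(\ell^2 f)(\varphi)(y) = 0$ otherwise. *)

(* Defs.v *)
From HB Require Import structures.
From mathcomp Require Import all_boot all_order all_algebra finmap.
From mathcomp Require Import complex.
From mathcomp Require Import all_classical all_reals.
From mathcomp Require Import topology ereal normedtype esum.
From mathcomp Require Import ring.
From mathcomp Require summability.
Set Implicit Arguments.
Unset Strict Implicit.
Unset Printing Implicit Defensive.
Import Order.TTheory GRing.Theory Num.Theory.
Import numFieldNormedType.Exports.
Local Open Scope classical_set_scope.
Local Open Scope ring_scope.

Section InnerProductTriangle.
Variables (C : numClosedFieldType) (V : lmodType C) (b : V -> V -> C).
Hypotheses (bP : forall u a v w, b u (a *: v + w) = a * b u v + b u w)
  (bC : forall u v, b v u = (b u v)^*) (b_gt0 : forall u, u != 0 -> 0 < b u u).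

Let b0r u : b u 0 = 0.
Proof. by have := bP u (-1) 0 0; rewrite scaler0 addr0 mulN1r addNr. Qed.

Let bDr u v w : b u (v + w) = b u v + b u w.
Proof. by have := bP u 1 v w; rewrite scale1r mul1r. Qed.

Let bZr u a v : b u (a *: v) = a * b u v.
Proof. by have := bP u a v 0; rewrite addr0 b0r addr0. Qed.

Let bDl u v w : b (v + w) u = b v u + b w u.
Proof. by rewrite bC bDr rmorphD/= -!bC. Qed.

Let bZl u a v : b (a *: v) u = a^* * b v u.
Proof. by rewrite bC bZr rmorphM/= -bC. Qed.

Let b_ge0 u : 0 <= b u u.
Proof. by have [->|/b_gt0/ltW//] := eqVneq u 0; rewrite b0r. Qed.

Lemma inner_CauchySchwarz u v : `|b u v| ^+ 2 <= b u u * b v v.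
Proof.
have [->|v0] := eqVneq v 0; first by rewrite !b0r normr0 expr0n mulr0.
have bv := b_gt0 v0.
have := b_ge0 (b v v *: u + (- b v u) *: v).
rewrite !(bDl, bDr, bZl, bZr) !rmorphN/= -!bC.
rewrite [X in 0 <= X](_ : _ = b v v * (b u u * b v v - `|b u v| ^+ 2)).
  by rewrite pmulr_rge0// subr_ge0.
rewrite (normCK (b u v)) -bC.
move: (b v v) (b u u) (b u v) (b v u) => x y z t.
by ring.
Qed.

Lemma inner_triangle u v :
  sqrtC (b (u + v) (u + v)) <= sqrtC (b u u) + sqrtC (b v v).
Proof.
have sq x : 0 <= sqrtC (b x x) by rewrite sqrtC_ge0.
rewrite -(@ler_pXn2r _ 2)// ?nnegrE ?addr_ge0// sqrtCK sqrrD !sqrtCK.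
rewrite bDl !bDr (bC u v).
have -> : b u u + b u v + ((b u v)^* + b v v) =
          b u u + 'Re (b u v) *+ 2 + b v v.
  by rewrite -mulr_natr ReE divfK ?pnatr_eq0// !addrA.
rewrite lerD2r lerD2l lerMn2r/=.
apply: (le_trans (leif_Re_Creal (b u v))).
rewrite -(@ler_pXn2r _ 2)// ?nnegrE ?mulr_ge0// exprMn !sqrtCK.
exact: inner_CauchySchwarz.
Qed.

End InnerProductTriangle.

(* The inner product is linear in its second argument.  As the scalars are
   R[i], the norm is R[i]-valued too (a nonnegative element of R[i]); the
   topology and the completeness are those of the norm. *)
HB.mixin Record isHilbert (R : realType) H & CompleteNormedModule R[i] H := {
  inner : H -> H -> R[i];
  innerP : forall (u : H) (a : R[i]) (v w : H),
    inner u (a *: v + w) = a * inner u v + inner u w;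
  inner_conj : forall u v, inner v u = (inner u v)^*;
  inner_normE : forall u, inner u u = `|u| ^+ 2 }.

#[short(type="hilbertType")]
HB.structure Definition Hilbert (R : realType) :=
  {H of CompleteNormedModule R[i] H & isHilbert R H}.

(* Builds a Hilbert space from an inner product, the norm being its square
   root; completeness is stated with the squared distance. *)
HB.factory Record Lmodule_isHilbert (R : realType) H & GRing.Lmodule R[i] H := {
  inner : H -> H -> R[i];
  innerP : forall (u : H) (a : R[i]) (v w : H),
    inner u (a *: v + w) = a * inner u v + inner u w;
  inner_conj : forall u v, inner v u = (inner u v)^*;
  inner_gt0 : forall u, u != 0 -> 0 < inner u u;
  inner_complete : forall F : set_system H, ProperFilter F ->
    (forall e, 0 < e -> \forall u & v \near F, inner (u - v) (u - v) < e) ->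
    exists l, forall e, 0 < e -> \forall v \near F, inner (l - v) (l - v) < e }.

HB.builders Context R H & Lmodule_isHilbert R H.

Let norm (u : H) : R[i] := sqrtC (inner u u).

Let inner0 u : inner u 0 = 0.
Proof. by have := innerP u (-1) 0 0; rewrite scaler0 addr0 mulN1r addNr. Qed.

Let inner_ge0 u : 0 <= inner u u.
Proof. by have [->|/inner_gt0/ltW//] := eqVneq u 0; rewrite inner0. Qed.

Let normD u v : norm (u + v) <= norm u + norm v.
Proof. exact: (inner_triangle innerP inner_conj inner_gt0). Qed.

Let normZ (a : R[i]) u : norm (a *: u) = `|a| * norm u.
Proof.
rewrite /norm; have iZ x v w : inner v (x *: w) = x * inner v w.
  by have := innerP v x w 0; rewrite !addr0 inner0 addr0.
rewrite iZ [in LHS]inner_conj iZ rmorphM/= -inner_conj mulrA -normCK.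
by rewrite sqrtCM ?qualifE/= ?exprn_ge0// sqrCK.
Qed.

Let norm0_eq0 u : norm u = 0 -> u = 0.
Proof.
move/eqP; rewrite sqrtC_eq0 => /eqP uu; apply/eqP/negPn/negP => /inner_gt0.
by rewrite uu ltxx.
Qed.

HB.instance Definition _ := Lmodule_isNormed.Build R[i] H normD normZ norm0_eq0.

Let inner_lt (u : H) (e : R[i]) : 0 < e -> (`|u| < e) = (inner u u < e ^+ 2).
Proof.
move=> e0; rewrite -[inner u u]sqrtCK ltr_pXn2r// nnegrE ?(ltW e0)//.
by rewrite sqrtC_ge0.
Qed.

Let cauchy_complete (F : set_system H) : ProperFilter F -> cauchy F -> cvg F.
Proof.
move=> FF /cauchy_ballP Fc.
have [|l Fl] := inner_complete FF.
  move=> e e0; have se0 : 0 < sqrtC e by rewrite sqrtC_gt0.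
  have := Fc _ se0; apply: filterS => -[u v]/=.
  by rewrite -ball_normE/= inner_lt// sqrtCK.
apply/cvg_ex; exists l; apply/cvgrPdist_lt => e e0.
by apply: filterS (Fl _ (exprn_gt0 2 e0)) => v/=; rewrite -inner_lt.
Qed.

HB.instance Definition _ := Uniform_isComplete.Build H cauchy_complete.

Let inner_normE (u : H) : inner u u = `|u| ^+ 2.
Proof. by rewrite sqrtCK. Qed.

HB.instance Definition _ :=
  isHilbert.Build R H innerP inner_conj inner_normE.

HB.end.

Section HilbertTheory.
Variables (R : realType) (H : hilbertType R).
Implicit Types u v w : H.

Lemma inner_ge0 u : 0 <= inner u u.
Proof. by rewrite inner_normE exprn_ge0// normr_ge0. Qed.

Lemma inner_gt0 u : u != 0 -> 0 < inner u u.
Proof. by move=> u0; rewrite inner_normE exprn_gt0// normr_gt0. Qed.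

Lemma inner_ltE u (e : R[i]) : 0 < e -> (inner u u < e ^+ 2) = (`|u| < e).
Proof.
by move=> e0; rewrite inner_normE ltr_pXn2r// nnegrE ?normr_ge0// ltW.
Qed.

End HilbertTheory.

Definition hzero (R : realType) : Type := unit.

Section HilbertZero.
Variable R : realType.

HB.instance Definition _ := Choice.on (hzero R).

Let hzero_eq (x y : hzero R) : x = y. Proof. by case: x; case: y. Qed.

HB.instance Definition _ := GRing.isZmodule.Build (hzero R)
  (fun x y z => hzero_eq _ _) (fun x y => hzero_eq _ _)
  (fun x => hzero_eq (tt : hzero R) x)
  (fun x => hzero_eq ((fun _ _ => tt) x x) tt).

HB.instance Definition _ := GRing.Zmodule_isLmodule.Build R[i] (hzero R)
  (scale := fun _ _ => tt)
  (fun _ _ _ => hzero_eq _ _) (fun _ => hzero_eq _ _)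
  (fun _ _ _ => hzero_eq _ _) (fun _ _ _ => hzero_eq _ _).

Let hzero_inner (u v : hzero R) : R[i] := 0.

Let hzero_innerP (u : hzero R) a v w :
  hzero_inner u (a *: v + w) = a * hzero_inner u v + hzero_inner u w.
Proof. by rewrite mulr0 addr0. Qed.

Let hzero_conj u v : hzero_inner v u = (hzero_inner u v)^*.
Proof. by rewrite conjC0. Qed.

Let hzero_gt0 u : u != 0 -> 0 < hzero_inner u u.
Proof. by rewrite (hzero_eq u 0) eqxx. Qed.

Let hzero_complete (F : set_system (hzero R)) : ProperFilter F ->
  (forall e, 0 < e ->
    \forall u & v \near F, hzero_inner (u - v) (u - v) < e) ->
  exists l, forall e, 0 < e ->
    \forall v \near F, hzero_inner (l - v) (l - v) < e.
Proof. by move=> FF _; exists 0 => e e0; exact: nearW. Qed.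

HB.instance Definition _ := Lmodule_isHilbert.Build R (hzero R)
  hzero_innerP hzero_conj hzero_gt0 hzero_complete.

End HilbertZero.

(* An alias of H * K, because the norm that the library puts on H * K is the
   maximum of the norms, which is not the norm of an inner product. *)
Definition hsum (R : realType) (H K : hilbertType R) : Type := (H * K)%type.

Section HilbertSum.
Variables (R : realType) (H K : hilbertType R).

HB.instance Definition _ := GRing.Lmodule.copy (hsum H K) (H * K)%type.

Let hsum_inner (u v : hsum H K) : R[i] := inner u.1 v.1 + inner u.2 v.2.

Let hsum_innerP (u : hsum H K) a v w :
  hsum_inner u (a *: v + w) = a * hsum_inner u v + hsum_inner u w.
Proof. by rewrite /hsum_inner/= !innerP mulrDr addrACA. Qed.

Let hsum_conj u v : hsum_inner v u = (hsum_inner u v)^*.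
Proof. by rewrite /hsum_inner rmorphD/= -!inner_conj. Qed.

Let hsum_gt0 u : u != 0 -> 0 < hsum_inner u u.
Proof.
case: u => u v; rewrite /hsum_inner/= -pair_eqE/= negb_and => /orP[] /inner_gt0.
  by move=> u0; rewrite ltr_wpDr// inner_ge0.
by move=> v0; rewrite ltr_wpDl// inner_ge0.
Qed.

Let hsum_complete (F : set_system (hsum H K)) : ProperFilter F ->
  (forall e, 0 < e ->
    \forall u & v \near F, hsum_inner (u - v) (u - v) < e) ->
  exists l, forall e, 0 < e ->
    \forall v \near F, hsum_inner (l - v) (l - v) < e.
Proof.
move=> FF Fc.
have c1 : cvg (fst @ F : set_system H).
  apply: cauchy_cvg; apply/cauchy_ballP => e e0.
  have := Fc _ (exprn_gt0 2 e0).
  rewrite !near_simpl => -[[A B]/= [FA FB] AB].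
  exists (fst @` A, fst @` B).
    split; [apply: filterS FA|apply: filterS FB] => x Ax /=; exists x => //.
  move=> [x y] /= [[a Aa <-] [b Bb <-]]; rewrite -ball_normE/= -inner_ltE//.
  apply: le_lt_trans (AB (a, b) (conj Aa Bb)).
  by rewrite /hsum_inner/= lerDl inner_ge0.
have c2 : cvg (snd @ F : set_system K).
  apply: cauchy_cvg; apply/cauchy_ballP => e e0.
  have := Fc _ (exprn_gt0 2 e0).
  rewrite !near_simpl => -[[A B]/= [FA FB] AB].
  exists (snd @` A, snd @` B).
    split; [apply: filterS FA|apply: filterS FB] => x Ax /=; exists x => //.
  move=> [x y] /= [[a Aa <-] [b Bb <-]]; rewrite -ball_normE/= -inner_ltE//.
  apply: le_lt_trans (AB (a, b) (conj Aa Bb)).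
  by rewrite /hsum_inner/= lerDr inner_ge0.
exists (lim (fst @ F), lim (snd @ F)) => e e0.
have e2 : 0 < sqrtC (e / 2) by rewrite sqrtC_gt0 divr_gt0.
move/cvgrPdist_lt : c1 => /(_ _ e2) c1; move/cvgrPdist_lt : c2 => /(_ _ e2) c2.
near=> v; rewrite /hsum_inner/= (splitr e) -(sqrtCK (e / 2)).
rewrite ltrD// inner_ltE//.
  by near: v.
by near: v.
Unshelve. all: by end_near. Qed.

HB.instance Definition _ := Lmodule_isHilbert.Build R (hsum H K)
  hsum_innerP hsum_conj hsum_gt0 hsum_complete.

End HilbertSum.

#[global] Existing Instance summability.totally_filter.

Section Sums.

Variables (C : numFieldType) (I : choiceType).
Implicit Types (f g : I -> C^o) (A B : {fset I}).

Let psum f A : C^o := \sum_(i <- A) f i.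

Lemma partial_sumE f : summability.partial_sum f = psum f.
Proof. by apply/funext => A; rewrite /summability.partial_sum /psum big_seq_fsetE. Qed.

Lemma psum_split f A B : (A `<=` B)%fset ->
  \sum_(i <- B) f i = \sum_(i <- A) f i + \sum_(i <- (B `\` A)%fset) f i.
Proof.
move=> AB; rewrite -big_cat; apply: perm_big; apply: uniq_perm => //.
  rewrite cat_uniq !fset_uniq andbT/=; apply/hasPn => i.
  by rewrite in_fsetD => /andP[].
move=> i; rewrite mem_cat in_fsetD; have := fsubsetP AB i.
by case: (i \in A) => //= ->.
Qed.

Lemma cvg_ge0 (T : Type) (F : set_system T) (FF : ProperFilter F)
    (g : T -> C^o) (l : C^o) :
  g @ F --> l -> (\forall t \near F, 0 <= g t) -> 0 <= l.
Proof.
move=> gl g0; have gl' : (fun t => `|g t| : C^o) @ F --> (`|l| : C^o).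
  exact: cvg_norm.
have gl2 : (fun t => `|g t| : C^o) @ F --> l.
  apply: cvg_trans gl; apply: near_eq_cvg.
  by apply: filterS g0 => t g0; rewrite ger0_norm.
have -> : l = `|l| := cvg_unique (@norm_hausdorff _ C^o) gl2 gl'.
exact: normr_ge0.
Qed.

Lemma lim_sum_sqnorm_le (T : Type) (F : set_system T) (FF : ProperFilter F)
    (g : I -> T -> C^o) (l c : I -> C^o) (r : seq I) (e : C) :
  (forall i, g i @ F --> l i) ->
  (\forall t \near F, \sum_(i <- r) `|g i t - c i| ^+ 2 <= e) ->
  \sum_(i <- r) `|l i - c i| ^+ 2 <= e.
Proof.
move=> gl ge; rewrite -subr_ge0.
apply: (@cvg_ge0 _ F _ (fun t => e - \sum_(i <- r) `|g i t - c i| ^+ 2)); last first.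
  by apply: filterS ge => t; rewrite subr_ge0.
apply: (@cvgB C C^o _ F _ _ _ e); first exact: cvg_cst.
elim: r {ge} => [|x r IHr].
  by under eq_fun do rewrite big_nil; rewrite big_nil; exact: cvg_cst.
under eq_fun do rewrite big_cons; rewrite big_cons.
have nx : (fun t => `|g x t - c x| : C^o) @ F --> (`|l x - c x| : C^o).
  apply: (@cvg_norm C C^o _ F _ (fun t => g x t - c x)).
  by apply: cvgB; [exact: gl|exact: cvg_cst].
exact: (cvgD (cvgM nx nx) IHr).
Qed.

Lemma sum_cvgE f (l : C^o) :
  psum f @ summability.totally --> l -> summability.sum f = l.
Proof. by rewrite /summability.sum partial_sumE => /(cvg_lim (@norm_hausdorff _ C^o)). Qed.

Lemma sum_linear (a : C) f g : cvg (psum f @ summability.totally) ->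
  cvg (psum g @ summability.totally) ->
  summability.sum (fun i => a * f i + g i : C^o) =
  a * summability.sum f + summability.sum g.
Proof.
move=> cf cg; apply: sum_cvgE.
rewrite /summability.sum !partial_sumE.
rewrite (_ : psum _ = (fun A => a *: psum f A + psum g A)); last first.
  by apply/funext => A; rewrite /psum big_split/= -mulr_sumr.
by apply: cvgD => //; apply: cvgZr.
Qed.

Lemma sum_ge f (A : {fset I}) : (forall i, 0 <= f i) ->
  cvg (psum f @ summability.totally) -> \sum_(i <- A) f i <= summability.sum f.
Proof.
move=> f0 cf; rewrite -subr_ge0.
apply: (@cvg_ge0 _ summability.totally _ (fun B => psum f B - psum f A)).
  by rewrite /summability.sum partial_sumE; apply: cvgB => //; exact: cvg_cst.
exists A => // B /= AB;rewrite /psum (psum_split _ AB) addrAC subrr add0r.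
by rewrite sumr_ge0.
Qed.

Lemma sum_le f M : (forall A, \sum_(i <- A) f i <= M) ->
  cvg (psum f @ summability.totally) -> summability.sum f <= M.
Proof.
move=> fM cf; rewrite -subr_ge0.
apply: (@cvg_ge0 _ summability.totally _ (fun B => M - psum f B)).
  by rewrite /summability.sum partial_sumE; apply: cvgB => //; exact: cvg_cst.
by apply: nearW => A; rewrite subr_ge0; exact: fM.
Qed.

End Sums.

Section ComplexSums.
Variable R : realType.

Lemma complex_ltR (z e : R[i]) : 0 < e -> `|z| < e ->
  `|complex.Re z| < complex.Re e /\ `|complex.Im z| < complex.Re e.
Proof.
case: e z => [e1 e2] [x y]/=; rewrite ltcE/= => /andP[/eqP -> e0].
rewrite normc_def/= ltcR => xy.
split; (apply: le_lt_trans xy; rewrite -sqrtr_sqr ler_sqrt ?addr_ge0 ?sqr_ge0//).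
  by rewrite lerDl sqr_ge0.
by rewrite lerDr sqr_ge0.
Qed.

Lemma complex_complete (F : set_system R[i]^o) :
  ProperFilter F -> cauchy F -> cvg F.
Proof.
move=> FF /cauchy_ballP Fc.
have cR : cvg ((@complex.Re R : R[i]^o -> R) @ F).
  apply: cauchy_cvg; apply/cauchy_ballP => e e0.
  have e0' : 0 < e%:C%C by rewrite ltcR.
  have [[A B]/= [FA FB] AB] := Fc _ e0'.
  exists (@complex.Re R @` A, @complex.Re R @` B).
    by split; [apply: filterS FA|apply: filterS FB] => x Ax /=; exists x.
  move=> [x y] /= [[a Aa <-] [b Bb <-]]; rewrite -ball_normE/=.
  have := AB (a, b) (conj Aa Bb); rewrite -ball_normE/= => /(complex_ltR e0')[].
  by case: (a) (b) => [? ?] [? ?].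
have cI : cvg ((@complex.Im R : R[i]^o -> R) @ F).
  apply: cauchy_cvg; apply/cauchy_ballP => e e0.
  have e0' : 0 < e%:C%C by rewrite ltcR.
  have [[A B]/= [FA FB] AB] := Fc _ e0'.
  exists (@complex.Im R @` A, @complex.Im R @` B).
    by split; [apply: filterS FA|apply: filterS FB] => x Ax /=; exists x.
  move=> [x y] /= [[a Aa <-] [b Bb <-]]; rewrite -ball_normE/=.
  have := AB (a, b) (conj Aa Bb); rewrite -ball_normE/= => /(complex_ltR e0')[].
  by case: (a) (b) => [? ?] [? ?].
apply/cvg_ex; exists (Complex (lim ((@complex.Re R : R[i]^o -> R) @ F))
                             (lim ((@complex.Im R : R[i]^o -> R) @ F))).
apply/cvgrPdist_lt => -[e e'] e0.
have := e0; rewrite ltcE/= => /andP[/eqP ee' er]; rewrite {e'}ee' in e0 *.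
have e2 : 0 < e / 2 by rewrite divr_gt0.
move/cvgrPdist_lt : cR => /(_ _ e2) cR; move/cvgrPdist_lt : cI => /(_ _ e2) cI.
near=> z.
have zR : `|lim ((@complex.Re R : R[i]^o -> R) @ F) - complex.Re z| < e / 2.
  by near: z.
have zI : `|lim ((@complex.Im R : R[i]^o -> R) @ F) - complex.Im z| < e / 2.
  by near: z.
move: zR zI; case: (z) => x y/=.
move: (lim _) (lim _) => a b ax bY.
rewrite normc_def/= ltcR (splitr e).
apply: le_lt_trans (ltrD ax bY).
rewrite -[leRHS]ger0_norm ?addr_ge0// -sqrtr_sqr ler_sqrt ?sqr_ge0//.
rewrite [leRHS]sqrrD !real_normK ?num_real// addrAC lerDl.
by rewrite mulrn_wge0// mulr_ge0.
Unshelve. all: by end_near. Qed.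

Variable I : choiceType.
Implicit Types (f g : I -> R[i]^o) (A B : {fset I}).

Let psum f A : R[i]^o := \sum_(i <- A) f i.

Lemma psum_cvg f (M : R[i]) : (forall A, \sum_(i <- A) `|f i| <= M) ->
  cvg (psum f @ summability.totally).
Proof.
move=> fM; apply: complex_complete; apply: cauchy_exP => e e0.
pose S A : R := complex.Re (\sum_(i <- A) `|f i|).
have SE A : (S A)%:C%C = \sum_(i <- A) `|f i|.
  have : 0 <= \sum_(i <- A) `|f i| by rewrite sumr_ge0.
  by rewrite /S; case: (\sum_(i <- A) _) => x y; rewrite lecE/= => /andP[/eqP->].
have M0 : 0 <= M by have := fM fset0; rewrite big_seq_fset0.
have SM A : S A <= complex.Re M.
  by have := fM A; rewrite -SE lecE/= => /andP[].
have hS : has_sup (range S).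
  by split; [exists (S fset0); exists fset0|exists (complex.Re M) => _ [A _ <-]].
have eE : e = (complex.Re e)%:C%C.
  by move: e0; case: (e) => x y; rewrite ltcE/= => /andP[/eqP->].
have e1 : 0 < complex.Re e by rewrite eE ltcR in e0.
have [_ [A0 _ <-] SA0] := sup_adherent e1 hS.
exists (psum f A0); exists A0 => // A /= AA0.
rewrite -ball_normE/= /psum (psum_split _ AA0) opprD addNKr normrN.
apply: le_lt_trans (ler_norm_sum _ _ _) _.
have -> : \sum_(i <- (A `\` A0)%fset) `|f i| = (S A - S A0)%:C%C.
  by rewrite rmorphB/= !SE (psum_split _ AA0) addrAC subrr add0r.
rewrite eE ltcR ltrBlDl -ltrBlDr; apply: le_lt_trans SA0.
by rewrite lerD2r; apply: ub_le_sup; [case: hS|exists A].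
Qed.

Lemma sum_conj f : cvg (psum f @ summability.totally) ->
  summability.sum (fun i => (f i)^* : R[i]^o) = (summability.sum f)^*.
Proof.
move=> cf; apply: sum_cvgE.
apply/cvgrPdist_lt => e e0.
move/cvgrPdist_lt : cf => /(_ _ e0); apply: filterS => A /=.
rewrite -rmorph_sum/= /summability.sum partial_sumE -rmorphB.
by rewrite norm_conjC.
Qed.

End ComplexSums.

(* Sums over an arbitrary set X are unconditional: they are taken over the
   finite subsets of X, with [{classic X}] supplying decidable equality. *)
Definition square_summable (R : realType) (X : Type) (phi : X -> R[i]) : Prop :=
  (\esum_(x in [set: {classic X}]) (Normc.normc (phi x) ^+ 2)%:E < +oo)%E.

Section SquareSummable.
Variables (R : realType) (X : Type).
Implicit Types (phi psi : X -> R[i]).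
Notation fin := {fset {classic X}}.

Lemma normc2E (z : R[i]) : `|z| ^+ 2 = (Normc.normc z ^+ 2)%:C%C.
Proof. by rewrite rmorphXn. Qed.

Lemma square_summableP phi : square_summable phi <->
  exists M : R[i], forall A : fin, \sum_(x <- A) `|phi x| ^+ 2 <= M.
Proof.
have sE (A : fin) : \sum_(x <- A) `|phi x| ^+ 2 =
    (\sum_(x <- A) Normc.normc (phi x) ^+ 2)%:C%C.
  by rewrite rmorph_sum; apply: eq_bigr => x _; rewrite normc2E.
have eE (A : fin) :
    (\sum_(x \in [set` A]) (Normc.normc (phi x) ^+ 2)%:E)%E =
    (\sum_(x <- A) Normc.normc (phi x) ^+ 2)%:E.
  by rewrite fsbig_finite//= set_fsetK sumEFin.
split=> [lt_oo|[M phiM]].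
  pose S := (\esum_(x in [set: {classic X}]) (Normc.normc (phi x) ^+ 2)%:E)%E.
  have Sfin : S \is a fin_num.
    rewrite ge0_fin_numE//.
    by apply: esum_ge0 => x _; rewrite lee_fin sqr_ge0.
  exists (fine S)%:C%C => A; rewrite sE lecR -lee_fin fineK// -eE.
  by apply: ereal_sup_ubound; exists [set` A].
rewrite /square_summable; apply: (@le_lt_trans _ _ (complex.Re M)%:E).
  apply: ge_ereal_sup => _ [A [Afin _] <-].
  have /finite_fsetP[A' ->] := Afin.
  rewrite eE lee_fin.
  by have := phiM A'; rewrite sE lecE/= => /andP[].
by rewrite ltry.
Qed.

Lemma square_summable0 : square_summable (fun _ : X => 0 : R[i]).
Proof.
by apply/square_summableP; exists 0 => A; rewrite big1// => x _; rewrite normr0 expr0n.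
Qed.

Lemma normcD2_le (z w : R[i]) :
  `|z + w| ^+ 2 <= (`|z| ^+ 2 + `|w| ^+ 2) *+ 2.
Proof.
apply: (@le_trans _ _ ((`|z| + `|w|) ^+ 2)).
  by rewrite ler_pXn2r ?nnegrE ?addr_ge0// ler_normD.
rewrite -subr_ge0 [X in 0 <= X](_ : _ = (`|z| - `|w|) ^+ 2); last by ring.
by rewrite real_exprn_even_ge0// rpredB// normr_real.
Qed.

Lemma square_summable_linear (a : R[i]) phi psi :
  square_summable phi -> square_summable psi ->
  square_summable (fun x => a * phi x + psi x).
Proof.
move=> /square_summableP[M phiM] /square_summableP[N psiN].
apply/square_summableP; exists ((`|a| ^+ 2 * M + N) *+ 2) => A.
apply: (@le_trans _ _
  (\sum_(x <- A) (`|a| ^+ 2 * `|phi x| ^+ 2 + `|psi x| ^+ 2) *+ 2)).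
  by apply: ler_sum => x _; rewrite -exprMn -normrM normcD2_le.
rewrite sumrMnl lerMn2r/= big_split/= lerD// -mulr_sumr.
by rewrite ler_wpM2l// exprn_ge0.
Qed.

Lemma square_summable_cvg phi psi :
  square_summable phi -> square_summable psi ->
  cvg ((fun A : fin => \sum_(x <- A) ((phi x)^* * psi x) : R[i]^o)
    @ summability.totally).
Proof.
move=> /square_summableP[M phiM] /square_summableP[N psiN].
apply: (@psum_cvg R _ (fun x : {classic X} => (phi x)^* * psi x) (M + N)) => A.
apply: (@le_trans _ _ (\sum_(x <- A) (`|phi x| ^+ 2 + `|psi x| ^+ 2))).
  apply: ler_sum => x _; rewrite normrM norm_conjC.
  rewrite -subr_ge0 -(pmulrn_lge0 _ (isT : (0 < 2)%N)).
  rewrite [X in 0 <= X](_ : _ =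
    `|phi x| ^+ 2 + `|psi x| ^+ 2 + (`|phi x| - `|psi x|) ^+ 2); last by ring.
  apply: addr_ge0; first by rewrite addr_ge0 ?exprn_ge0.
  by rewrite real_exprn_even_ge0// rpredB// normr_real.
by rewrite big_split lerD.
Qed.

End SquareSummable.

Definition ell2_pred (R : realType) (X : Type) : {pred X -> R[i]} :=
  fun phi => `[< square_summable phi >].

Record ell2 (R : realType) (X : Type) : Type :=
  Ell2 { ell2_fun :> X -> R[i]; ell2_mem : ell2_fun \in @ell2_pred R X }.

Section Ell2Space.
Variables (R : realType) (X : Type).
Notation fin := {fset {classic X}}.

HB.instance Definition _ := [isSub for @ell2_fun R X].
HB.instance Definition _ := [Choice of ell2 R X by <:].

Lemma ell2_submod : submod_closed (@ell2_pred R X).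
Proof.
split=> [|a u v /asboolP u2 /asboolP v2]; apply/asboolP.
  exact: square_summable0.
exact: square_summable_linear.
Qed.

HB.instance Definition _ :=
  GRing.isSubmodClosed.Build R[i] (X -> R[i]) (@ell2_pred R X) ell2_submod.
HB.instance Definition _ := [SubChoice_isSubLmodule of ell2 R X by <:].

Lemma ell2_summable (phi : ell2 R X) : square_summable phi.
Proof. by apply/asboolP; exact: ell2_mem. Qed.

Lemma ell2_linE (a : R[i]) (phi psi : ell2 R X) x :
  (a *: phi + psi) x = a * phi x + psi x.
Proof. by []. Qed.

Lemma ell2_eq (phi psi : ell2 R X) : phi =1 psi -> phi = psi.
Proof. by move=> e; apply/val_inj/funext. Qed.

Definition ell2_inner (phi psi : ell2 R X) : R[i] :=
  summability.sum (fun x : {classic X} => (phi x)^* * psi x : R[i]^o).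

Let inner_cvg (phi psi : ell2 R X) :=
  square_summable_cvg (ell2_summable phi) (ell2_summable psi).

Lemma ell2_innerP (u : ell2 R X) a v w :
  ell2_inner u (a *: v + w) = a * ell2_inner u v + ell2_inner u w.
Proof.
have uE : (fun x : {classic X} => (u x)^* * (a *: v + w) x : R[i]^o) =
    (fun x => a * ((u x)^* * v x) + (u x)^* * w x).
  by apply/funext => x; rewrite ell2_linE mulrDr mulrCA.
rewrite /ell2_inner uE.
exact: (sum_linear a (@inner_cvg u v) (@inner_cvg u w)).
Qed.

Lemma ell2_innerC u v : ell2_inner v u = (ell2_inner u v)^*.
Proof.
have uE : (fun x : {classic X} => (v x)^* * u x : R[i]^o) =
    (fun x => ((u x)^* * v x)^*).
  by apply/funext => x; rewrite rmorphM/= conjCK mulrC.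
rewrite /ell2_inner uE.
exact: (sum_conj (@inner_cvg u v)).
Qed.

Lemma ell2_inner_norm2E u :
  ell2_inner u u = summability.sum (fun x : {classic X} => `|u x| ^+ 2 : R[i]^o).
Proof.
rewrite /ell2_inner.
suff -> : (fun x : {classic X} => (u x)^* * u x : R[i]^o) =
  (fun x => `|u x| ^+ 2) by [].
by apply/funext => x; rewrite mulrC -normCK.
Qed.

Let norm2_cvg (u : ell2 R X) :
  cvg ((fun A : fin => \sum_(x <- A) `|u x| ^+ 2 : R[i]^o)
    @ summability.totally).
Proof.
have := @inner_cvg u u.
suff -> : (fun A : fin => \sum_(x <- A) (u x)^* * u x : R[i]^o) =
  (fun A => \sum_(x <- A) `|u x| ^+ 2) by [].
by apply/funext => A; apply: eq_bigr => x _; rewrite mulrC -normCK.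
Qed.

Lemma ell2_inner_ge (u : ell2 R X) (A : fin) :
  \sum_(x <- A) `|u x| ^+ 2 <= ell2_inner u u.
Proof.
rewrite ell2_inner_norm2E.
by apply: (@sum_ge _ _ (fun x : {classic X} => `|u x| ^+ 2 : R[i]^o)) => // x;
  exact: exprn_ge0.
Qed.

Lemma ell2_inner_le (u : ell2 R X) (M : R[i]) :
  (forall A : fin, \sum_(x <- A) `|u x| ^+ 2 <= M) -> ell2_inner u u <= M.
Proof.
move=> uM; rewrite ell2_inner_norm2E.
exact: (@sum_le _ _ (fun x : {classic X} => `|u x| ^+ 2 : R[i]^o)).
Qed.

Lemma ell2_eval_le (u : ell2 R X) x : `|u x| ^+ 2 <= ell2_inner u u.
Proof.
by have := ell2_inner_ge u [fset (x : {classic X})]%fset; rewrite big_seq_fset1.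
Qed.

Lemma ell2_inner_gt0 u : u != 0 -> 0 < ell2_inner u u.
Proof.
move=> u0; have [x ux] : exists x, u x != 0.
  apply: contrapT => /forallNP u00; move/eqP: u0; apply; apply: ell2_eq => x.
  by apply/eqP/negPn/negP; exact: u00.
apply: lt_le_trans (ell2_eval_le u x).
by rewrite exprn_gt0// normr_gt0.
Qed.

Lemma ell2_complete (F : set_system (ell2 R X)) : ProperFilter F ->
  (forall e, 0 < e -> \forall u & v \near F, ell2_inner (u - v) (u - v) < e) ->
  exists l, forall e, 0 < e -> \forall v \near F, ell2_inner (l - v) (l - v) < e.
Proof.
move=> FF Fc.
have ev_cvg x : cvg ((fun u : ell2 R X => u x : R[i]^o) @ F).
  apply: complex_complete; apply/cauchy_ballP => e e0.
  have [[A B]/= [FA FB] AB] := Fc _ (exprn_gt0 2 e0).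
  exists ((fun u : ell2 R X => u x) @` A, (fun u : ell2 R X => u x) @` B).
    by split; [apply: filterS FA|apply: filterS FB] => u Au /=; exists u.
  move=> [y z] /= [[a Aa <-] [b Bb <-]]; rewrite -ball_normE/=.
  rewrite -(@ltr_pXn2r _ 2)// ?nnegrE ?(ltW e0)//.
  exact: le_lt_trans (ell2_eval_le (a - b) x) (AB (a, b) (conj Aa Bb)).
pose l x : R[i] := lim ((fun u : ell2 R X => u x : R[i]^o) @ F).
have near_l e : 0 < e -> F [set u : ell2 R X | forall A : fin,
    \sum_(x <- A) `|l x - u x| ^+ 2 <= e].
  move=> e0; have [[P Q]/= [FP FQ] PQ] := Fc _ e0.
  apply: filterS FP => u Pu A.
  apply: (@lim_sum_sqnorm_le _ _ _ F _ (fun (x : {classic X}) (v : ell2 R X) =>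
    v x : R[i]^o) l u); first exact: ev_cvg.
  apply: filterS FQ => v Qv; apply: ltW.
  apply: le_lt_trans (PQ (u, v) (conj Pu Qv)).
  apply: le_trans (ell2_inner_ge (u - v) A).
  by under eq_bigr do rewrite distrC.
have l2 : l \in @ell2_pred R X.
  apply/asboolP.
  have [u uA] := filter_ex (near_l 1 ltr01).
  have lu : square_summable (fun x => l x - u x).
    by apply/square_summableP; exists 1.
  have := square_summable_linear 1 lu (ell2_summable u).
  by congr square_summable; apply/funext => x; rewrite mul1r subrK.
exists (Ell2 l2) => e e0.
have e2 : 0 < e / 2 by rewrite divr_gt0.
apply: filterS (near_l _ e2) => u uA.
apply: (@le_lt_trans _ _ (e / 2)); first exact: ell2_inner_le.
by rewrite ltr_pdivrMr// ltr_pMr// ltr1n.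
Qed.

HB.instance Definition _ := Lmodule_isHilbert.Build R (ell2 R X)
  ell2_innerP ell2_innerC ell2_inner_gt0 ell2_complete.

End Ell2Space.

Reserved Notation "g \oc f" (at level 40, left associativity).

Record category := Category {
  obj :> Type;
  hom : obj -> obj -> Type;
  idm : forall A, hom A A;
  ccomp : forall A B C, hom B C -> hom A B -> hom A C;
  comp1m : forall A B (f : hom A B), ccomp (idm B) f = f;
  compm1 : forall A B (f : hom A B), ccomp f (idm A) = f;
  compmA : forall A B C D (h : hom C D) (g : hom B C) (f : hom A B),
    ccomp h (ccomp g f) = ccomp (ccomp h g) f }.

Arguments hom {c} A B.
Arguments idm {c} A.
Arguments ccomp {c A B C} g f.
Notation "g \oc f" := (ccomp g f).

Definition is_iso (C : category) (A B : C) (f : hom A B) : Prop :=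
  exists g : hom B A, g \oc f = idm A /\ f \oc g = idm B.

Record functor (C D : category) := Functor {
  fobj :> C -> D;
  fmor : forall A B : C, hom A B -> hom (fobj A) (fobj B);
  fmor1 : forall A : C, fmor (idm A) = idm (fobj A);
  fmorM : forall (A B E : C) (g : hom B E) (f : hom A B),
    fmor (g \oc f) = fmor g \oc fmor f }.

Arguments fmor {C D} F {A B} f : rename.

Record symMonCategory := SymMonCategory {
  smc_cat :> category;
  tens : smc_cat -> smc_cat -> smc_cat;
  tensm : forall A A' B B' : smc_cat,
    hom A A' -> hom B B' -> hom (tens A B) (tens A' B');
  munit : smc_cat;
  assoc : forall A B C, hom (tens (tens A B) C) (tens A (tens B C));
  lunit : forall A, hom (tens munit A) A;
  runit : forall A, hom (tens A munit) A;
  braid : forall A B, hom (tens A B) (tens B A);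
  tensm1 : forall A B, tensm (idm A) (idm B) = idm (tens A B);
  tensmM : forall A A' A'' B B' B'' (f' : hom A' A'') (f : hom A A')
      (g' : hom B' B'') (g : hom B B'),
    tensm (f' \oc f) (g' \oc g) = tensm f' g' \oc tensm f g;
  assoc_iso : forall A B C, is_iso (assoc A B C);
  lunit_iso : forall A, is_iso (lunit A);
  runit_iso : forall A, is_iso (runit A);
  assoc_nat : forall A A' B B' C C' (f : hom A A') (g : hom B B') (h : hom C C'),
    assoc A' B' C' \oc tensm (tensm f g) h =
    tensm f (tensm g h) \oc assoc A B C;
  lunit_nat : forall A B (f : hom A B),
    lunit B \oc tensm (idm munit) f = f \oc lunit A;
  runit_nat : forall A B (f : hom A B),
    runit B \oc tensm f (idm munit) = f \oc runit A;
  braid_nat : forall A A' B B' (f : hom A A') (g : hom B B'),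
    braid A' B' \oc tensm f g = tensm g f \oc braid A B;
  pentagon : forall A B C D,
    assoc A B (tens C D) \oc assoc (tens A B) C D =
    tensm (idm A) (assoc B C D) \oc assoc A (tens B C) D
      \oc tensm (assoc A B C) (idm D);
  triangle : forall A B,
    tensm (idm A) (lunit B) \oc assoc A munit B = tensm (runit A) (idm B);
  braidK : forall A B, braid B A \oc braid A B = idm (tens A B);
  hexagon : forall A B C,
    assoc B C A \oc braid A (tens B C) \oc assoc A B C =
    tensm (idm B) (braid A C) \oc assoc B A C \oc tensm (braid A B) (idm C) }.

Arguments tens {s} A B.
Arguments tensm {s A A' B B'} f g.
Arguments munit {s}.
Arguments assoc {s} A B C.
Arguments lunit {s} A.
Arguments runit {s} A.
Arguments braid {s} A B.

(* The coherence conditions for the structure morphisms eps : I -> F I and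
   mu : F A (x) F B -> F (A (x) B), in this direction, both invertible. *)
Record is_symmetric_strong_monoidal (C D : symMonCategory) (F : functor C D)
    (eps : hom munit (F munit))
    (mu : forall A B : C, hom (tens (F A) (F B)) (F (tens A B))) : Prop :=
  IsSymmetricStrongMonoidal {
  eps_iso : is_iso eps;
  mu_iso : forall A B, is_iso (mu A B);
  mu_nat : forall (A A' B B' : C) (f : hom A A') (g : hom B B'),
    mu A' B' \oc tensm (fmor F f) (fmor F g) = fmor F (tensm f g) \oc mu A B;
  mu_assoc : forall A B E : C,
    fmor F (assoc A B E) \oc mu (tens A B) E \oc tensm (mu A B) (idm (F E)) =
    mu A (tens B E) \oc tensm (idm (F A)) (mu B E) \oc assoc (F A) (F B) (F E);
  mu_lunit : forall A : C,
    fmor F (lunit A) \oc mu munit A \oc tensm eps (idm (F A)) = lunit (F A);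
  mu_runit : forall A : C,
    fmor F (runit A) \oc mu A munit \oc tensm (idm (F A)) eps = runit (F A);
  mu_braid : forall A B : C,
    fmor F (braid A B) \oc mu A B = mu B A \oc braid (F A) (F B) }.

(* A partial injection: None marks the points outside its domain. *)
Record pinj (X Y : Type) := PInjMor {
  pinj_fun :> X -> option Y;
  pinjP : forall x x' y, pinj_fun x = Some y -> pinj_fun x' = Some y -> x = x' }.

Lemma pinj_eq (X Y : Type) (f g : pinj X Y) : f =1 g -> f = g.
Proof.
case: f g => [f fP] [g gP]/= /funext fg; case: _ / fg gP => gP.
by rewrite (Prop_irrelevance fP gP).
Qed.

Definition pinj_of (X Y : Type) (f : X -> Y) (f_inj : injective f) : pinj X Y.
Proof. by exists (Some \o f) => x x' y [<-] [/f_inj]. Defined.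

Definition pinj_id (X : Type) : pinj X X := pinj_of (@inj_id X).

Definition pinj_comp (X Y Z : Type) (g : pinj Y Z) (f : pinj X Y) : pinj X Z.
Proof.
exists (fun x => obind g (f x)) => x x' z.
case fx: (f x) => [y|]//= gy; case fx': (f x') => [y'|]//= gy'.
by rewrite (pinjP gy gy') in fx; exact: pinjP fx fx'.
Defined.

Definition pinj_sum (X X' Y Y' : Type) (f : pinj X X') (g : pinj Y Y') :
  pinj (X + Y) (X' + Y').
Proof.
exists (fun z => match z with
  | inl x => omap inl (f x) | inr y => omap inr (g y) end).
by move=> [x|y] [x'|y'] z; [case fx: (f x) => [u|]//|case fx: (f x) => [u|]//|
    case fx: (g y) => [u|]//|case fx: (g y) => [u|]//] => -[<-];
  [case fx': (f x') => [u'|]//|case fx': (g y') => [u'|]//|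
    case fx': (f x') => [u'|]//|case fx': (g y') => [u'|]//] => -[uu'];
  congr (_ _); rewrite uu' in fx'; exact: pinjP fx fx'.
Defined.

Definition PInj_cat : category.
Proof.
refine (@Category Type pinj pinj_id pinj_comp _ _ _).
- by move=> X Y f; apply: pinj_eq => x /=; case: (f x).
- by move=> X Y f; apply: pinj_eq.
- by move=> X Y Z T h g f; apply: pinj_eq => x /=; case: (f x).
Defined.

Definition sum_assoc (X Y Z : Type) (t : (X + Y) + Z) : X + (Y + Z) :=
  match t with
  | inl (inl x) => inl x | inl (inr y) => inr (inl y) | inr z => inr (inr z)
  end.

Definition sum_assoc_inv (X Y Z : Type) (t : X + (Y + Z)) : (X + Y) + Z :=
  match t with
  | inl x => inl (inl x) | inr (inl y) => inl (inr y) | inr (inr z) => inr z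
  end.

Definition sum_lunit (X : Type) (t : void + X) : X :=
  match t with inl v => match v with end | inr x => x end.

Definition sum_runit (X : Type) (t : X + void) : X :=
  match t with inl x => x | inr v => match v with end end.

Definition sum_swap (X Y : Type) (t : X + Y) : Y + X :=
  match t with inl x => inr x | inr y => inl y end.

Lemma sum_assocK X Y Z : cancel (@sum_assoc X Y Z) (@sum_assoc_inv X Y Z).
Proof. by move=> [[x|y]|z]. Qed.

Lemma sum_assoc_invK X Y Z : cancel (@sum_assoc_inv X Y Z) (@sum_assoc X Y Z).
Proof. by move=> [x|[y|z]]. Qed.

Lemma sum_lunitK X : cancel (@sum_lunit X) inr. Proof. by case. Qed.

Lemma sum_runitK X : cancel (@sum_runit X) inl. Proof. by case. Qed.

Lemma sum_swapK X Y : cancel (@sum_swap X Y) (@sum_swap Y X).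
Proof. by case. Qed.

Lemma pinj_of_iso (X Y : Type) (f : X -> Y) (g : Y -> X)
    (fg : cancel f g) (gf : cancel g f) (f_inj : injective f) :
  @is_iso PInj_cat X Y (pinj_of f_inj).
Proof.
by exists (pinj_of (can_inj gf)); split; apply: pinj_eq => x /=; rewrite ?fg ?gf.
Qed.

Definition PInj : symMonCategory.
Proof.
refine (@SymMonCategory PInj_cat sum pinj_sum void
  (fun X Y Z => pinj_of (can_inj (@sum_assocK X Y Z)))
  (fun X => pinj_of (can_inj (@sum_lunitK X)))
  (fun X => pinj_of (can_inj (@sum_runitK X)))
  (fun X Y => pinj_of (can_inj (@sum_swapK X Y)))
  _ _ _ _ _ _ _ _ _ _ _ _ _).
- by move=> X Y; apply: pinj_eq => -[].
- move=> X X' X'' Y Y' Y'' f' f g' g; apply: pinj_eq => -[x|y] /=.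
    by case: (f x).
  by case: (g y).
- move=> X Y Z.
  exact: (pinj_of_iso (@sum_assocK X Y Z) (@sum_assoc_invK X Y Z)).
- by move=> X; apply: (pinj_of_iso (@sum_lunitK X)).
- by move=> X; apply: (pinj_of_iso (@sum_runitK X)).
- move=> X X' Y Y' Z Z' f g h; apply: pinj_eq => -[[x|y]|z] /=.
  + by case: (f x).
  + by case: (g y).
  + by case: (h z).
- by move=> X Y f; apply: pinj_eq => -[[]|x] /=; case: (f x).
- by move=> X Y f; apply: pinj_eq => -[x|[]] /=; case: (f x).
- move=> X X' Y Y' f g; apply: pinj_eq => -[x|y] /=.
    by case: (f x).
  by case: (g y).
- by move=> X Y Z T; apply: pinj_eq => -[[[]|]|].
- by move=> X Y; apply: pinj_eq => -[[x|[]]|y].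
- by move=> X Y; apply: pinj_eq => -[].
- by move=> X Y Z; apply: pinj_eq => -[[]|].
Defined.

Record cont_linear (R : realType) (H K : hilbertType R) := ContLinear {
  cl_fun :> H -> K;
  cl_linear : linear cl_fun;
  cl_continuous : continuous cl_fun }.

Section ContLinear.
Variable R : realType.
Implicit Types H K L : hilbertType R.

Lemma cl_eq H K (f g : cont_linear H K) : f =1 g -> f = g.
Proof.
case: f g => [f fl fc] [g gl gc]/= /funext fg; case: _ / fg gl gc => gl gc.
by rewrite (Prop_irrelevance fl gl) (Prop_irrelevance fc gc).
Qed.

Lemma linear_subE H K (f : H -> K) : linear f -> {morph f : u v / u - v}.
Proof. by move=> fl u v; have := fl (-1) v u; rewrite !scaleN1r ![- _ + _]addrC. Qed.

Lemma linear_contraction H K (f : H -> K) : linear f ->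
  (forall u, inner (f u) (f u) <= inner u u) -> continuous f.
Proof.
move=> fl f_le u; apply/cvgrPdist_lt => e e0.
have : \forall v \near u, `|u - v| < e by apply: cvgr_dist_lt.
apply: filterS => v /=; rewrite -(linear_subE fl) -!inner_ltE//.
exact: le_lt_trans.
Qed.

Definition cl_contraction H K (f : H -> K) (fl : linear f)
    (f_le : forall u, inner (f u) (f u) <= inner u u) : cont_linear H K :=
  ContLinear fl (linear_contraction fl f_le).

Lemma hsum_innerE H K (u v : hsum H K) :
  inner u v = inner u.1 v.1 + inner u.2 v.2.
Proof. by []. Qed.

Lemma hsum_fst_continuous H K : continuous (fst : hsum H K -> H).
Proof.
by apply: linear_contraction => // u; rewrite hsum_innerE lerDl inner_ge0.
Qed.

Lemma hsum_snd_continuous H K : continuous (snd : hsum H K -> K).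
Proof.
by apply: linear_contraction => // u; rewrite hsum_innerE lerDr inner_ge0.
Qed.

Lemma hsum_continuous (T : topologicalType) H K (f : T -> hsum H K) :
  continuous (fst \o f : T -> H) -> continuous (snd \o f : T -> K) ->
  continuous f.
Proof.
move=> f1 f2 t; apply/cvgrPdist_lt => e e0.
have e2 : 0 < sqrtC (e ^+ 2 / 2) by rewrite sqrtC_gt0 divr_gt0// exprn_gt0.
have /cvgrPdist_lt/(_ _ e2) c1 := f1 t; have /cvgrPdist_lt/(_ _ e2) c2 := f2 t.
near=> s; rewrite -inner_ltE// hsum_innerE (splitr (e ^+ 2)).
rewrite -(sqrtCK (e ^+ 2 / 2)) ltrD// inner_ltE//.
  by near: s.
by near: s.
Unshelve. all: by end_near. Qed.

Definition cl_id H : cont_linear H H.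
Proof. by apply: (@cl_contraction _ _ id). Defined.

Definition cl_comp H K L (g : cont_linear K L) (f : cont_linear H K) :
  cont_linear H L.
Proof.
exists (g \o f).
  by move=> a u v /=; rewrite (cl_linear f) (cl_linear g).
move=> u; apply: continuous_comp; exact: cl_continuous.
Defined.

Definition cl_sum H H' K K' (f : cont_linear H H') (g : cont_linear K K') :
  cont_linear (hsum H K) (hsum H' K').
Proof.
exists (fun u => (f u.1, g u.2)).
  by move=> a u v /=; rewrite (cl_linear f) (cl_linear g).
apply: hsum_continuous => u.
  by apply: (@continuous_comp (hsum H K) H H' fst f u);
    [exact: hsum_fst_continuous|exact: cl_continuous].
by apply: (@continuous_comp (hsum H K) K K' snd g u);
  [exact: hsum_snd_continuous|exact: cl_continuous].
Defined.

Definition cl_assoc H K L : cont_linear (hsum (hsum H K) L) (hsum H (hsum K L)).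
Proof.
apply: (@cl_contraction
  (hsum (hsum H K) L) (hsum H (hsum K L)) (fun u => (u.1.1, (u.1.2, u.2)))) => // u.
by rewrite !hsum_innerE/= addrA.
Defined.

Definition cl_assoc_inv H K L :
  cont_linear (hsum H (hsum K L)) (hsum (hsum H K) L).
Proof.
apply: (@cl_contraction
  (hsum H (hsum K L)) (hsum (hsum H K) L) (fun u => ((u.1, u.2.1), u.2.2))) => // u.
by rewrite !hsum_innerE/= addrA.
Defined.

Definition cl_lunit H : cont_linear (hsum (hzero R) H) H.
Proof.
by apply: (@cl_contraction
  (hsum (hzero R) H) H snd) => // u; rewrite hsum_innerE lerDr inner_ge0.
Defined.

Definition cl_lunit_inv H : cont_linear H (hsum (hzero R) H).
Proof.
apply: (@cl_contraction
  H (hsum (hzero R) H) (fun u => (0 : hzero R, u))) => [a u v|u].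
  by congr (_, _); rewrite scaler0 addr0.
by rewrite hsum_innerE/= [X in X + _]inner_normE normr0 expr0n add0r.
Defined.

Definition cl_runit H : cont_linear (hsum H (hzero R)) H.
Proof.
by apply: (@cl_contraction
  (hsum H (hzero R)) H fst) => // u; rewrite hsum_innerE lerDl inner_ge0.
Defined.

Definition cl_runit_inv H : cont_linear H (hsum H (hzero R)).
Proof.
apply: (@cl_contraction
  H (hsum H (hzero R)) (fun u => (u, 0 : hzero R))) => [a u v|u].
  by congr (_, _); rewrite scaler0 addr0.
by rewrite hsum_innerE/= [X in _ + X]inner_normE normr0 expr0n addr0.
Defined.

Definition cl_swap H K : cont_linear (hsum H K) (hsum K H).
Proof.
by apply: (@cl_contraction
  (hsum H K) (hsum K H) (fun u => (u.2, u.1))) => // u;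
  rewrite !hsum_innerE/= addrC.
Defined.

End ContLinear.

Definition Hilb_cat (R : realType) : category.
Proof.
by refine (@Category (hilbertType R) (@cont_linear R) (@cl_id R) (@cl_comp R)
  _ _ _) => *; apply: cl_eq.
Defined.

Definition Hilb (R : realType) : symMonCategory.
Proof.
refine (@SymMonCategory (Hilb_cat R) (@hsum R) (@cl_sum R) (hzero R)
  (@cl_assoc R) (@cl_lunit R) (@cl_runit R) (@cl_swap R)
  _ _ _ _ _ _ _ _ _ _ _ _ _).
- by move=> H K; apply: cl_eq => -[].
- by move=> *; apply: cl_eq.
- move=> H K L; exists (cl_assoc_inv H K L).
  by split; apply: cl_eq; [move=> [[]]|move=> [? []]].
- move=> H; exists (cl_lunit_inv H).
  by split; apply: cl_eq => // -[[] u].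
- move=> H; exists (cl_runit_inv H).
  by split; apply: cl_eq => // -[u []].
- by move=> *; apply: cl_eq.
- by move=> *; apply: cl_eq.
- by move=> *; apply: cl_eq.
- by move=> *; apply: cl_eq.
- by move=> *; apply: cl_eq.
- by move=> *; apply: cl_eq.
- by move=> H K; apply: cl_eq => -[].
- by move=> *; apply: cl_eq.
Defined.

Section Ell2Functor.
Variable R : realType.

(* The pushforward of phi along f: the value at f x is phi x, and the value
   outside the range of f is 0. *)
Definition ell2_push (X Y : Type) (f : pinj X Y) (phi : X -> R[i]) (y : Y) :
    R[i] :=
  if pselect (exists x, f x = Some y) is left fy then phi (projT1 (cid fy))
  else 0.

Lemma ell2_pushE (X Y : Type) (f : pinj X Y) phi x y :
  f x = Some y -> ell2_push f phi y = phi x.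
Proof.
move=> fx; rewrite /ell2_push; case: pselect => [fy|[]]; last by exists x.
by case: cid => x' /= fx'; congr phi; exact: pinjP fx' fx.
Qed.

Lemma ell2_push0 (X Y : Type) (f : pinj X Y) phi y :
  (forall x, f x <> Some y) -> ell2_push f phi y = 0.
Proof.
by move=> fy; rewrite /ell2_push; case: pselect => // -[x fx]; case: (fy x).
Qed.

Lemma ell2_push_sum (X Y : Type) (f : pinj X Y) (phi : X -> R[i])
    (B : {fset {classic Y}}) : exists A : {fset {classic X}},
  \sum_(y <- B) `|ell2_push f phi y| ^+ 2 = \sum_(x <- A) `|phi x| ^+ 2.
Proof.
suff [s [us _ ->]] : exists s : seq {classic X}, [/\ uniq s,
    (forall x, x \in s -> exists2 y, y \in (enum_fset B) & f x = Some y) &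
    \sum_(y <- B) `|ell2_push f phi y| ^+ 2 = \sum_(x <- s) `|phi x| ^+ 2].
  exists [fset x in s]%fset; apply: perm_big; apply: uniq_perm => //.
    exact: fset_uniq.
  by move=> x; rewrite in_fset.
elim: (enum_fset B) (fset_uniq B) => [_|y r IHr /= /andP[yr ur]].
  by exists [::]; rewrite !big_nil.
have [s [us sr sE]] := IHr ur.
have [[x fx]|nfy] := pselect (exists x, f x = Some y); last first.
  exists s; split => //; first by move=> x /sr[z zr fx]; exists z; rewrite// inE zr orbT.
  rewrite big_cons ell2_push0 ?normr0 ?expr0n ?add0r// => x fx.
  by apply: nfy; exists x.
exists (x :: s); split.
- rewrite /= us andbT; apply/negP => /sr[z zr]; rewrite fx => -[yz].
  by rewrite yz zr in yr.
- move=> x'; rewrite inE => /orP[/eqP ->|/sr[z zr fz]].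
    by exists y => //; exact: mem_head.
  by exists z => //; rewrite inE zr orbT.
- by rewrite !big_cons (ell2_pushE _ fx) sE.
Qed.

Lemma ell2_push_mem (X Y : Type) (f : pinj X Y) (phi : ell2 R X) :
  ell2_push f phi \in @ell2_pred R Y.
Proof.
apply/asboolP/square_summableP; exists (ell2_inner phi phi) => B.
by have [A ->] := ell2_push_sum f phi B; exact: ell2_inner_ge.
Qed.

Lemma ell2_push_linear (X Y : Type) (f : pinj X Y) :
  linear (fun phi : ell2 R X => Ell2 (ell2_push_mem f phi)).
Proof.
move=> a phi psi; apply: ell2_eq => y; rewrite ell2_linE/=.
by rewrite /ell2_push; case: pselect => // _; rewrite mulr0 addr0.
Qed.

Lemma ell2_push_le (X Y : Type) (f : pinj X Y) (phi : ell2 R X) :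
  inner (Ell2 (ell2_push_mem f phi)) (Ell2 (ell2_push_mem f phi)) <=
  inner phi phi.
Proof.
apply: ell2_inner_le => B.
by have [A ->] := ell2_push_sum f phi B; exact: ell2_inner_ge.
Qed.

Definition ell2_map (X Y : Type) (f : pinj X Y) :
    cont_linear (ell2 R X) (ell2 R Y) :=
  cl_contraction (ell2_push_linear f) (ell2_push_le f).

Lemma ell2_map1 (X : Type) : ell2_map (pinj_id X) = cl_id (ell2 R X).
Proof. by apply: cl_eq => phi; apply: ell2_eq => x; exact: ell2_pushE. Qed.

Lemma ell2_mapM (X Y Z : Type) (g : pinj Y Z) (f : pinj X Y) :
  ell2_map (pinj_comp g f) = cl_comp (ell2_map g) (ell2_map f).
Proof.
apply: cl_eq => phi; apply: ell2_eq => z /=.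
have [[y gy]|nz] := pselect (exists y, g y = Some z); last first.
  rewrite [RHS]ell2_push0; last by move=> y gy; apply: nz; exists y.
  rewrite ell2_push0// => x /=; case: (f x) => //= y gy.
  by apply: nz; exists y.
rewrite (ell2_pushE _ gy)/=.
have [[x fx]|ny] := pselect (exists x, f x = Some y).
  by rewrite (ell2_pushE _ fx) (@ell2_pushE _ _ _ _ x)//= fx.
rewrite [RHS]ell2_push0; last by move=> x fx; apply: ny; exists x.
rewrite ell2_push0// => x /=; case fx: (f x) => [y'|]//= gy'.
by apply: ny; exists x; rewrite fx (pinjP gy' gy).
Qed.

Definition ell2_functor : functor PInj (Hilb R) :=
  @Functor PInj (Hilb R) (fun X => ell2 R X) ell2_map ell2_map1 ell2_mapM.

End Ell2Functor.

Definition cotuple (X Y Z : Type) (phi : X -> Z) (psi : Y -> Z) (t : X + Y) : Z :=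
  match t with inl x => phi x | inr y => psi y end.

(* Main.v *)
Require Import Defs.
From mathcomp Require Import all_boot all_order all_algebra complex.
From mathcomp Require Import all_classical all_reals.
From mathcomp Require Import topology normedtype.

(** The idea is to let partial injections do the analysis.  The cotuple of
    [phi] and [psi] is the sum of the pushforwards of [phi] along [inl] and of
    [psi] along [inr] ([ell2_cotuple_fct]).  Pushforwards are continuous linear
    maps between [ell2] spaces, so the cotuple is square summable, and depends
    linearly and continuously on the pair, without any estimate on sums over
    [X + Y].  The same remark inverts it: restricting a function on [X + Y] to
    a summand is pushing it forward along the partial injection that reverses
    [inl] or [inr] ([ell2_uncotuple]).  The unit morphism is the zero map, an
    isomorphism because there is only one function on the empty set.

    What remains are equations between functions.  The structure morphisms of
    [PInj] are bijections, and pushing forward along a bijection is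
    precomposition with its inverse ([ell2_push_can]), so after a case analysis
    on the point of the disjoint union both sides of a coherence condition
    evaluate the same function at the same point.  Only naturality involves
    arbitrary partial injections, and there a point of a summand has the same
    preimage under [pinj_sum f g] as under [f] or [g] ([ell2_push_suml],
    [ell2_push_sumr]). *)

Set Implicit Arguments.
Unset Strict Implicit.
Unset Printing Implicit Defensive.
Import GRing.Theory.
Import numFieldNormedType.Exports.
Local Open Scope ring_scope.

Section Summands.
Variables X Y : Type.

Definition pinj_inl : pinj X (X + Y) :=
  pinj_of (fun x x' (e : inl x = inl x' :> X + Y) => inl_inj e).

Definition pinj_inr : pinj Y (X + Y) :=
  pinj_of (fun y y' (e : inr y = inr y' :> X + Y) => inr_inj e).

(** The partial inverse of [pinj_inl]; pushing forward along it restricts a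
    function to the left summand. *)
Definition pinj_unl : pinj (X + Y) X.
Proof.
exists (fun t => if t is inl x then Some x else None).
by move=> [x|y] [x'|y'] z //= [->] [->].
Defined.

Definition pinj_unr : pinj (X + Y) Y.
Proof.
exists (fun t => if t is inr y then Some y else None).
by move=> [x|y] [x'|y'] z //= [->] [->].
Defined.

End Summands.

Section Hilbert.
Variable R : realType.
Implicit Types H K L : hilbertType R.

Definition cl_copair H K L (f : cont_linear H L) (g : cont_linear K L) :
  cont_linear (hsum H K) L.
Proof.
exists (fun u => f u.1 + g u.2).
  by move=> a u v; rewrite !cl_linear scalerDr addrACA.
have fc : continuous (f \o fst : hsum H K -> L).
  move=> u; apply: (@continuous_comp (hsum H K) H L fst f u).
    exact: hsum_fst_continuous.
  exact: cl_continuous.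
have gc : continuous (g \o snd : hsum H K -> L).
  move=> u; apply: (@continuous_comp (hsum H K) K L snd g u).
    exact: hsum_snd_continuous.
  exact: cl_continuous.
by move=> u; exact: (continuousD (fc u) (gc u)).
Defined.

Definition cl_zero H K : cont_linear H K.
Proof.
exists (fun _ => 0); first by move=> a u v; rewrite scaler0 addr0.
by move=> u; exact: cvg_cst.
Defined.

End Hilbert.

Section Pushforward.
Variable R : realType.

Lemma ell2_addE (X : Type) (phi psi : ell2 R X) x :
  (phi + psi) x = phi x + psi x.
Proof. by have := ell2_linE 1 phi psi x; rewrite scale1r mul1r. Qed.

Lemma ell2_push_can (X Y : Type) (f : X -> Y) (g : Y -> X)
    (f_inj : injective f) (phi : X -> R[i]) (y : Y) :
  cancel g f -> ell2_push (pinj_of f_inj) phi y = phi (g y).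
Proof. by move=> gK; apply: ell2_pushE => /=; rewrite gK. Qed.

(** A pushforward sees only the value at the preimage of a point: if [h] carries
    the preimage of [y] to that of [y'], and neither exists without the other,
    the two pushforwards agree there.  It serves to compare [pinj_sum f g] with
    [f] or [g]. *)
Lemma ell2_push_eq (X Y X' Y' : Type) (f : pinj X Y) (f' : pinj X' Y')
    (h : X -> X') (phi : X -> R[i]) (phi' : X' -> R[i]) (y : Y) (y' : Y') :
  (forall x, f x = Some y -> f' (h x) = Some y') ->
  (forall x', f' x' = Some y' -> exists x, f x = Some y) ->
  phi' \o h =1 phi -> ell2_push f' phi' y' = ell2_push f phi y.
Proof.
move=> ff' f'f phi_h.
have [[x fx]|nfy] := pselect (exists x, f x = Some y).
  by rewrite (ell2_pushE phi fx) (ell2_pushE phi' (ff' _ fx)) -phi_h.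
rewrite !ell2_push0 // => [x fx|x' /f'f //].
by apply: nfy; exists x.
Qed.

Lemma ell2_push_suml (X X' Y Y' : Type) (f : pinj X X') (g : pinj Y Y')
    (chi : X + Y -> R[i]) (x : X') :
  ell2_push (pinj_sum f g) chi (inl x) = ell2_push f (chi \o inl) x.
Proof.
apply: (@ell2_push_eq _ _ _ _ _ _ inl) => [z /= -> //|[z|z] /=|//].
  by case E: (f z) => [w|]//= -[<-]; exists z.
by case: (g z).
Qed.

Lemma ell2_push_sumr (X X' Y Y' : Type) (f : pinj X X') (g : pinj Y Y')
    (chi : X + Y -> R[i]) (y : Y') :
  ell2_push (pinj_sum f g) chi (inr y) = ell2_push g (chi \o inr) y.
Proof.
apply: (@ell2_push_eq _ _ _ _ _ _ inr) => [z /= -> //|[z|z] /=|//].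
  by case: (f z).
by case E: (g z) => [w|]//= -[<-]; exists z.
Qed.

End Pushforward.

Section Cotuple.
Variables (R : realType) (X Y : Type).
Implicit Types (phi : ell2 R X) (psi : ell2 R Y).

Let copair := cl_copair (ell2_map R (pinj_inl X Y)) (ell2_map R (pinj_inr X Y)).

(** A point of the disjoint union has a preimage under exactly one of the two
    injections, so one pushforward gives the value and the other vanishes. *)
Lemma ell2_cotuple_fct phi psi : cotuple phi psi = copair (phi, psi) :> (_ -> _).
Proof.
apply/funext => -[x|y]; rewrite ell2_addE /=.
- rewrite (@ell2_pushE _ _ _ (pinj_inl X Y) phi x)//.
  by rewrite (@ell2_push0 _ _ _ (pinj_inr X Y))// addr0.
- rewrite (@ell2_pushE _ _ _ (pinj_inr X Y) psi y)//.
  by rewrite (@ell2_push0 _ _ _ (pinj_inl X Y))// add0r.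
Qed.

Lemma ell2_cotuple_mem phi psi : cotuple phi psi \in @ell2_pred R (X + Y).
Proof. by rewrite ell2_cotuple_fct; exact: ell2_mem. Qed.

(** The underlying function is the cotuple itself, rather than the sum
   of pushforwards, so that the coherence conditions hold by computation. *)
Let cot (u : hsum (ell2 R X) (ell2 R Y)) : ell2 R (X + Y) :=
  Ell2 (ell2_cotuple_mem u.1 u.2).

Let cotE : cot = copair.
Proof.
apply/funext => -[phi psi]; apply: ell2_eq => t.
by rewrite -ell2_cotuple_fct.
Qed.

Let cot_linear : linear cot.
Proof. by rewrite cotE; exact: cl_linear. Qed.

Let cot_continuous : continuous cot.
Proof. by rewrite cotE; exact: cl_continuous. Qed.

Definition ell2_cotuple :
    cont_linear (hsum (ell2 R X) (ell2 R Y)) (ell2 R (X + Y)%type) :=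
  ContLinear cot_linear cot_continuous.

Definition ell2_uncotuple :
  cont_linear (ell2 R (X + Y)%type) (hsum (ell2 R X) (ell2 R Y)).
Proof.
exists (fun chi => (ell2_map R (pinj_unl X Y) chi,
                    ell2_map R (pinj_unr X Y) chi)).
  by move=> a u v; rewrite !cl_linear.
by apply: hsum_continuous; exact: cl_continuous.
Defined.

Lemma ell2_unlE (chi : X + Y -> R[i]) x :
  ell2_push (pinj_unl X Y) chi x = chi (inl x).
Proof. exact: ell2_pushE. Qed.

Lemma ell2_unrE (chi : X + Y -> R[i]) y :
  ell2_push (pinj_unr X Y) chi y = chi (inr y).
Proof. exact: ell2_pushE. Qed.

Lemma ell2_cotuple_iso : @is_iso (Hilb R) _ _ ell2_cotuple.
Proof.
exists ell2_uncotuple; split; apply: cl_eq.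
  move=> [phi psi]; congr (_, _); apply: ell2_eq => z /=.
    by rewrite ell2_unlE.
  by rewrite ell2_unrE.
by move=> chi; apply: ell2_eq => -[x|y] /=; rewrite (ell2_unlE, ell2_unrE).
Qed.

End Cotuple.

Lemma ell2_void_iso (R : realType) :
  @is_iso (Hilb R) _ _ (cl_zero (hzero R) (ell2 R void)).
Proof.
exists (cl_zero (ell2 R void) (hzero R)); split; apply: cl_eq; first by case.
by move=> u; apply: ell2_eq.
Qed.

Theorem mainTheorem9 (R : realType) :
  exists (eps : cont_linear (hzero R) (ell2 R void))
         (mu : forall X Y : Type,
            cont_linear (hsum (ell2 R X) (ell2 R Y)) (ell2 R (X + Y)%type)),
    (forall (X Y : Type) (phi : ell2 R X) (psi : ell2 R Y),
        ell2_fun (mu X Y (phi, psi)) = cotuple phi psi) /\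
    @is_symmetric_strong_monoidal PInj (Hilb R) (ell2_functor R) eps mu.
Proof.
exists (cl_zero (hzero R) (ell2 R void)), (@ell2_cotuple R).
split=> //; split.
- exact: ell2_void_iso.
- exact: ell2_cotuple_iso.
- move=> X X' Y Y' f g; apply: cl_eq => -[phi psi].
  by apply: ell2_eq => -[x|y] /=; rewrite (ell2_push_suml, ell2_push_sumr).
- move=> X Y Z; apply: cl_eq => -[[phi psi] chi]; apply: ell2_eq => t /=.
  rewrite (ell2_push_can _ _ _ (@sum_assoc_invK X Y Z)).
  by case: t => [x|[y|z]].
- move=> X; apply: cl_eq => -[u phi]; apply: ell2_eq => x /=.
  by rewrite (@ell2_push_can _ _ _ _ inr).
- move=> X; apply: cl_eq => -[phi u]; apply: ell2_eq => x /=.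
  by rewrite (@ell2_push_can _ _ _ _ inl).
- move=> X Y; apply: cl_eq => -[phi psi]; apply: ell2_eq => t /=.
  rewrite (ell2_push_can _ _ _ (@sum_swapK Y X)).
  by case: t.
Qed.
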